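(* For every graph $G$ with minimum degree $\delta(G)$, $$\mathrm{pw}(L(G)) \geq \mathrm{tw}(L(G)) \geq \begin{cases} \frac{1}{4}\delta(G)^2+\delta(G)-1 & \text{when } \delta(G) \text{ is even},\\ \frac{1}{4}\delta(G)^2+\delta(G)-\frac{5}{4} & \text{when } \delta(G) \text{ is odd}.\end{cases}$$
   Context: Graphs are finite, simple and undirected, and $G$ has at least one vertex. The line graph $L(G)$ has vertex set $E(G)$, two distinct elements being adjacent if and only if the corresponding edges of $G$ share an endpoint. A tree decomposition of a graph $H$ is a (nonempty) tree $T$ together with a collection of subsets of $V(H)$ (bags) indexed by the nodes of $T$ such that: every vertex of $H$ is in at least one bag; for each vertex $v$ of $H$, the nodes whose bags contain $v$ induce a connected subtree of $T$; and for each edge of $H$ some bag contains both its endpoints. Its width is the size of the largest bag minus 1. The treewidth $\mathrm{tw}(H)$ is the minimum width of a tree decomposition of $H$; the pathwidth $\mathrm{pw}(H)$ is the minimum width over tree decompositions whose tree $T$ is a path. (If $H$ has no vertices, $\mathrm{tw}(H)=\mathrm{pw}(H)=-1$.) *)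

(* Defs.v *)
From HB Require Import structures.
From mathcomp Require Import all_boot all_order all_algebra.
From mathcomp Require Import boolp.

Set Implicit Arguments.
Unset Strict Implicit.
Unset Printing Implicit Defensive.

Import Order.TTheory GRing.Theory Num.Theory.

Record sgraph := SGraph {
  vertex :> finType;
  adj : rel vertex;
  adj_sym : symmetric adj;
  adj_irr : irreflexive adj
}.

Arguments adj {s}.

Definition degree (G : sgraph) (x : G) : nat := #|[set y | adj x y]|.

(* Every degree is less than #|G|, so for nonempty G the default value #|G|
   never contributes to the minimum. *)
Definition min_degree (G : sgraph) : nat := \big[minn/#|G|]_(x : G) degree x.

Definition edges (G : sgraph) : {set {set G}} :=
  [set [set p.1; p.2] | p : G * G & adj p.1 p.2].

Definition edge (G : sgraph) : finType := {A : {set G} | A \in edges G}.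

Definition line_adj (G : sgraph) (A B : edge G) : bool :=
  (A != B) && (val A :&: val B != set0).

Lemma line_adj_sym (G : sgraph) : symmetric (@line_adj G).
Proof. by move=> A B; rewrite /line_adj eq_sym setIC. Qed.

Lemma line_adj_irr (G : sgraph) : irreflexive (@line_adj G).
Proof. by move=> A; rewrite /line_adj eqxx. Qed.

Definition line_graph (G : sgraph) : sgraph :=
  SGraph (@line_adj_sym G) (@line_adj_irr G).

Definition connected_in (G : sgraph) (S : {set G}) : Prop :=
  {in S &, forall x y, connect [rel u v in S | adj u v] x y}.

(* [ucycle adj [:: x; y]] holds for every edge xy, so the genuine cycles are
   the duplicate-free ones with at least three vertices. *)
Definition acyclic (G : sgraph) : Prop :=
  forall c : seq G, ucycle adj c -> size c <= 2.

Definition is_tree (T : sgraph) : Prop :=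
  [/\ 0 < #|T|, connected_in [set: T] & acyclic T].

Definition is_path (T : sgraph) : Prop :=
  exists s : seq T,
    [/\ uniq s, forall x, x \in s
      & forall x y, adj x y =
          ((index x s).+1 == index y s) || ((index y s).+1 == index x s)].

Record tree_decomposition (H T : sgraph) (B : T -> {set H}) : Prop := TreeDec {
  td_tree : is_tree T;
  td_cover : forall v : H, exists i : T, v \in B i;
  td_connected : forall v : H, connected_in [set i | v \in B i];
  td_edge : forall u v : H, adj u v -> exists i : T, (u \in B i) && (v \in B i)
}.

(* Integer-valued: the width is -1 when all bags are empty. *)
Definition width (H T : sgraph) (B : T -> {set H}) : int :=
  ((\max_(i : T) #|B i|)%:Z - 1)%R.

(* The argument n is the width plus one, which is always a natural number. *)
Definition has_tree_decomposition (H : sgraph) (n : nat) : Prop :=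
  exists (T : sgraph) (B : T -> {set H}),
    tree_decomposition B /\ width B = (n%:Z - 1)%R.

Definition has_path_decomposition (H : sgraph) (n : nat) : Prop :=
  exists (T : sgraph) (B : T -> {set H}),
    [/\ tree_decomposition B, is_path T & width B = (n%:Z - 1)%R].

Lemma single_node_sym : symmetric (fun _ _ : unit => false).
Proof. by []. Qed.

Lemma single_node_irr : irreflexive (fun _ : unit => fun _ : unit => false).
Proof. by []. Qed.

Definition single_node : sgraph := SGraph single_node_sym single_node_irr.

Lemma single_node_decomposition (H : sgraph) :
  tree_decomposition (fun _ : single_node => [set: H]).
Proof.
split.
- split; first by rewrite card_unit.
  + by move=> [] [] _ _; exact: connect0.
  + by case=> [|[] [|[] c]].
- by move=> v; exists tt; rewrite inE.
- by move=> v [] [] _ _; exact: connect0.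
- by move=> u v _; exists tt; rewrite !inE.
Qed.

Lemma single_node_path : is_path single_node.
Proof. by exists [:: tt]; split=> // [[]|[] []]. Qed.

Lemma path_decomposition_exists (H : sgraph) :
  exists n, `[< has_path_decomposition H n >].
Proof.
exists (\max_(i : single_node) #|[set: H]|); apply/asboolP.
exists single_node, (fun=> [set: H]).
by split; [exact: single_node_decomposition | exact: single_node_path |].
Qed.

Lemma tree_decomposition_exists (H : sgraph) :
  exists n, `[< has_tree_decomposition H n >].
Proof.
have [n /asboolP[T [B [dB _ wB]]]] := path_decomposition_exists H.
by exists n; apply/asboolP; exists T, B.
Qed.

Definition treewidth (H : sgraph) : int :=
  ((ex_minn (tree_decomposition_exists H))%:Z - 1)%R.

Definition pathwidth (H : sgraph) : int :=
  ((ex_minn (path_decomposition_exists H))%:Z - 1)%R.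

(* Main.v *)
(* In a tree decomposition of the line graph, the edges at a vertex v form a
   clique, so by the Helly property of subtrees some node b v has all of them
   in its bag.  Root the tree and let t be a lowest node whose subtree is home
   to more than h = floor (d / 2) vertices, where d >= 2 is the minimum degree
   (smaller d are immediate).  The bag of t
   contains every edge of G whose endpoints lie in different parts, the parts
   being the sets of vertices with home in one component of T - t, and the
   singletons {v} with b v = t.  By the choice of t, all parts below t have at
   most h vertices.  A minimal union A of such parts with more than h vertices
   splits into a part of size s <= h and a rest of size r <= h; counting the
   edges at A that leave their part gives at least
   (d + 1) (s + r) - s^2 - r^2 - s r of them, and this is at least
   d + floor (d^2 / 4) since s, r <= h < s + r. *)
Require Import Defs.
From mathcomp Require Import all_boot all_order all_algebra.
From mathcomp Require Import zify lra.

Import Order.TTheory GRing.Theory Num.Theory.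
Local Open Scope ring_scope.

(** * Branches of a tree and the Helly property *)

Section Trees.
Local Open Scope nat_scope.

Lemma connect_exit {T : finType} {e : rel T} {P : pred T} {x y} :
    connect e x y -> P x -> ~~ P y ->
  exists u v, [/\ connect e x u, e u v, P u & ~~ P v].
Proof.
move=> /connectP[p]; elim: p x => [|z p IHp] x /=.
  by move=> _ -> Px; rewrite Px.
case/andP=> exz ezp eqy Px nPy.
have [Pz|nPz] := boolP (P z); last by exists x, z.
have [u [v [zu euv Pu nPv]]] := IHp z ezp eqy Pz nPy.
by exists u, v; split=> //; exact: connect_trans (connect1 exz) zu.
Qed.

Definition avoid {T : sgraph} (t : T) : rel T := [rel u v in [set~ t] | adj u v].

Lemma avoidE {T : sgraph} (t u v : T) :
  avoid t u v = [&& u != t, v != t & adj u v].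
Proof. by rewrite /avoid /= !inE andbA. Qed.

Lemma avoid_sym {T : sgraph} (t : T) : symmetric (avoid t).
Proof. by move=> u v; rewrite !avoidE andbCA adj_sym. Qed.

Lemma connect_avoid_sym {T : sgraph} (t : T) : connect_sym (avoid t).
Proof. exact/sym_connect_sym/avoid_sym. Qed.

Lemma connect_avoid_neq {T : sgraph} {t u v : T} :
  connect (avoid t) u v -> u != t -> v != t.
Proof.
move=> uv; suff clA : closed (avoid t) [set~ t].
  by have := closed_connect clA uv; rewrite !inE => ->.
apply: intro_closed => [|x y]; first exact: connect_avoid_sym.
by rewrite avoidE !inE => /and3P[].
Qed.

Lemma connected_in_avoid {T : sgraph} {S : {set T}} {t x y : T} :
  connected_in S -> t \notin S -> x \in S -> y \in S -> connect (avoid t) x y.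
Proof.
move=> cS tS xS yS; apply: connect_sub (cS x y xS yS) => u v /= /andP[/andP[uS vS] uv].
apply: connect1; rewrite avoidE uv andbT.
by apply/andP; split; apply: contraNneq tS => <-.
Qed.

(** Otherwise a duplicate-free path from [c] to [c'] avoiding [t] would close up through [t] into a
    cycle with at least three vertices. *)
Lemma acyclic_nbr_eq {T : sgraph} {t c c' : T} :
  acyclic T -> adj t c -> adj t c' -> connect (avoid t) c c' -> c = c'.
Proof.
move=> acT tc tc' /connectP[p0 /shortenP[p pP up _] c'E {p0}].
case: p => [|z p] in pP up c'E => //.
suff: ucycle adj [:: t, c, z & p] by move/acT.
have path_adj : path adj c (z :: p).
  by apply: sub_path pP => u v; rewrite avoidE => /and3P[].
have nt : t \notin z :: p.
  apply/negP=> tzp; elim: (z :: p) c pP tzp {up tc c'E path_adj} => // a s IHs c /=.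
  rewrite avoidE inE => /andP[/and3P[_ aNt _] pas] /predU1P[ta|/(IHs _ pas)//].
  by rewrite ta eqxx in aNt.
have tNc : t != c by apply: contraTneq tc => ->; rewrite adj_irr.
rewrite /ucycle cons_uniq up in_cons negb_or tNc nt /= tc.
move: path_adj => /=/andP[-> pa]; rewrite rcons_path pa /=.
by move: c'E => /= <-; rewrite adj_sym tc'.
Qed.

(* [D t] is the subtree hanging below [t] once a root is chosen. *)
Lemma tree_branches {T : sgraph} : is_tree T ->
  exists D : T -> {set T}, [/\ exists r, D r = [set: T],
    forall t x y, x \in D t -> x != t -> connect (avoid t) x y -> y \in D t
  & forall t x, x \in D t -> x != t ->
      exists2 c, #|D c| < #|D t| & forall y, connect (avoid t) x y -> y \in D c].
Proof.
case=> /card_gt0P[r _] conT acT.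
have nbr (t z : T) : z != t -> exists2 c, adj t c & connect (avoid t) z c.
  move=> zt.
  have tz : connect adj z t.
    by apply: connect_sub (conT z t (in_setT _) (in_setT _)) => u v /= /andP[_ /connect1].
  have nt : ~~ connect (avoid t) z t.
    by apply/negP => /connect_avoid_neq/(_ zt); rewrite eqxx.
  have [u [v [_ uv zu nzv]]] := connect_exit tz (connect0 _ z) nt.
  have ut := connect_avoid_neq zu zt.
  exists u => //; have [<-|vt] := eqVneq v t; first by rewrite adj_sym.
  case/negP: nzv; apply: connect_trans zu (connect1 _).
  by rewrite avoidE ut vt.
(* Below [t] lies [t] itself and whatever its removal cuts off from the root [r]. *)
exists (fun t => [set x | (x == t) || ~~ connect (avoid t) r x]); split.
- exists r; apply/setP=> x; rewrite !inE; have [//|/= xr] := eqVneq x r.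
  by apply/negP; rewrite connect_avoid_sym => /connect_avoid_neq/(_ xr); rewrite eqxx.
- move=> t x y; rewrite !inE => /predU1P[->|rx]; first by rewrite eqxx.
  move=> _ xy; apply/orP; right; apply: contra rx => ry.
  by apply: connect_trans ry _; rewrite connect_avoid_sym.
move=> t x; rewrite inE => /predU1P[->|rx xt]; first by rewrite eqxx.
have [c tc xc] := nbr t x xt.
have ct := connect_avoid_neq xc xt.
have nrc : ~~ connect (avoid t) r c.
  by apply: contra rx => rc; apply: connect_trans rc _; rewrite connect_avoid_sym.
have avoid_c y : connect (avoid t) r y -> connect (avoid c) r y.
  move=> ry; apply/negP => /negP nry.
  have [u [v [ru uv cu ncv]]] := connect_exit ry (connect0 (avoid c) r) nry.
  case/negP: ncv; apply: connect_trans cu (connect1 _).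
  have rv := connect_trans ru (connect1 uv).
  move: uv; rewrite !avoidE => /and3P[_ _ ->]; rewrite andbT.
  by apply/andP; split; apply: contraNneq nrc => <-.
exists c.
  apply: proper_card; apply/properP; split.
    apply/subsetP=> y; rewrite !inE => /predU1P[->|]; first by rewrite nrc orbT.
    by move=> ncy; rewrite (contra (avoid_c y) ncy) orbT.
  exists t; rewrite !inE ?eqxx // eq_sym (negbTE ct) /= negbK.
  have [->|rt] := eqVneq r t; first exact: connect0.
  have [p tp rp] := nbr t r rt.
  apply: connect_trans (avoid_c _ rp) (connect1 _).
  rewrite avoidE [t == c]eq_sym ct adj_sym tp !andbT.
  by apply: contraNneq nrc => <-.
move=> y xy; rewrite inE; have [//|/= yc] := eqVneq y c.
apply/negP; rewrite connect_avoid_sym => ry.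
(* A walk from [y] to [r] avoiding [c] must leave the component of [x] in [T - t]. It can only do so
   into [t], from a neighbour of [t], and by acyclicity that neighbour is [c]. *)
have nxr : ~~ connect (avoid t) x r by rewrite connect_avoid_sym.
have [u [v [_ uv xu nxv]]] := connect_exit ry xy nxr.
have ut := connect_avoid_neq xu xt.
move: uv; rewrite avoidE => /and3P[uc vc uv].
have vt : v = t.
  apply/eqP; apply: contraNT nxv => vt.
  by apply: connect_trans xu (connect1 _); rewrite avoidE ut vt.
suff uEc : u = c by rewrite uEc eqxx in uc.
apply: acyclic_nbr_eq acT _ tc _; first by rewrite -vt adj_sym.
by apply: connect_trans xc; rewrite connect_avoid_sym.
Qed.

(** Take a lowest [t] whose subtree contains a whole [S i]. If [S j] missed [t], then being
    connected and meeting [S i] it would lie in a single branch below [t], against the choice of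
    [t]. *)
Lemma helly_tree {T : sgraph} {I : finType} {S : I -> {set T}} (i0 : I) :
    is_tree T -> (forall i, connected_in (S i)) ->
    (forall i j, S i :&: S j != set0) ->
  exists t, forall i, t \in S i.
Proof.
move=> treeT cS meetS.
have [D [[r Dr] _ child]] := tree_branches treeT.
have Pr : [exists i, S i \subset D r] by apply/existsP; exists i0; rewrite Dr subsetT.
case: (@arg_minnP _ r (fun t => [exists i, S i \subset D t])
  (fun t => #|D t|) Pr) => t /existsP[i SiD] minD.
exists t => j; apply/negPn/negP => tSj.
have /set0Pn[x /setIP[xi xj]] := meetS i j.
have xt : x != t by apply: contraNneq tSj => <-.
have [c ltc Dc] := child t x (subsetP SiD x xi) xt.
suff: #|D t| <= #|D c| by rewrite leqNgt ltc.
apply: minD; apply/existsP; exists j; apply/subsetP => y yj.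
exact/Dc/(connected_in_avoid (cS j)).
Qed.

End Trees.

(** * Counting edges between the classes of a partition *)

Section Counting.
Local Open Scope nat_scope.

Lemma min_degree_le {G : sgraph} (x : G) : min_degree G <= degree x.
Proof.
rewrite /min_degree; have := mem_index_enum x.
elim: (index_enum G) => // y s IHs; rewrite inE big_cons geq_min.
by case/predU1P=> [<-|/IHs->]; rewrite ?leqnn ?orbT.
Qed.

Lemma degree_lt_card {G : sgraph} (x : G) : degree x < #|G|.
Proof.
rewrite -cardsT; apply/proper_card/properP; split; first exact: subsetT.
by exists x; rewrite !inE ?adj_irr.
Qed.

Lemma set2_eqP {T : finType} {x y v w : T} :
  [set x; y] = [set v; w] -> x != y -> (x, y) = (v, w) \/ (x, y) = (w, v).
Proof.
move=> E xy.
have : x \in [set v; w] by rewrite -E !inE eqxx.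
have : y \in [set v; w] by rewrite -E !inE eqxx orbT.
by rewrite !inE => /orP[]/eqP ye /orP[]/eqP xe; move: xy; rewrite xe ye ?eqxx //; auto.
Qed.

Lemma card_pairs_le {T : finType} (P : {set T * T}) :
  (forall p, p \in P -> p.1 != p.2) ->
  #|P| <= 2 * #|[set [set p.1; p.2] | p in P]|.
Proof.
move=> neqP; pose f (p : T * T) := [set p.1; p.2].
rewrite -sum1_card (partition_big f (mem (f @: P))) /=; last first.
  by move=> p pP; exact: imset_f.
rewrite mulnC -sum_nat_const; apply: leq_sum => _ /imsetP[[v w] vwP ->].
rewrite sum1_card; apply: leq_trans (card_size [:: (v, w); (w, v)]).
apply/subset_leq_card/subsetP => -[x y]; rewrite !inE => /andP[xyP /eqP E].
have [->|->] := set2_eqP E (neqP _ xyP); by rewrite ?eqxx ?orbT.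
Qed.

Definition cross_pairs {G : sgraph} {K : eqType} (q : G -> K) : {set G * G} :=
  [set p | adj p.1 p.2 && (q p.1 != q p.2)].

Definition cross_edges {G : sgraph} {K : eqType} (q : G -> K) : {set {set G}} :=
  [set [set p.1; p.2] | p in cross_pairs q].

(* A vertex of [A] whose class has size [f] has at least [d + 1 - f] neighbours
   outside that class, of which at most [#|A| - f] lie in [A]; only the edges
   to the latter are counted from both ends. *)
Lemma cross_edges_lower {G : sgraph} {K : eqType} {q : G -> K} {A : {set G}} {d} :
    (forall v : G, d <= degree v) ->
    {in A, forall v, [set w | q w == q v] \subset A} ->
  2 * (d + 1) * #|A| <=
    2 * #|cross_edges q| + #|A| ^ 2 + \sum_(v in A) #|[set w | q w == q v]|.
Proof.
move=> dG clA.
pose c v w : nat := adj v w && (q v != q w).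
have cC v w : c v w = c w v by rewrite /c adj_sym eq_sym.
have cross_le : \sum_v \sum_w c v w <= 2 * #|cross_edges q|.
  apply: leq_trans (card_pairs_le (cross_pairs q) _); last first.
    by move=> p; rewrite inE => /andP[_]; apply: contraNneq => ->.
  rewrite pair_big /= -sum1_card big_mkcond [X in _ <= X]big_mkcond /=.
  by apply: leq_sum => p _; rewrite inE /c; case: ifP.
(* Pairs leaving [A] are counted a second time from their outer end. *)
have split_sum :
    \sum_(v in A) (\sum_w c v w + \sum_(w | w \notin A) c v w)
      <= \sum_v \sum_w c v w.
  rewrite big_split /= [X in _ <= X](bigID (mem A)) /= leq_add2l exchange_big /=.
  apply: leq_sum => v _; rewrite [X in _ <= X](bigID (mem A)) /=.
  by under eq_bigr do rewrite cC; exact: leq_addr.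
(* Below, [s] and [r] count the neighbours of [v] outside its class, inside and outside [A]. Adding
   [s + #|F| <= #|A|] to twice [d + 1 <= s + r + #|F|] gives the claim. *)
have vertex v : v \in A -> 2 * (d + 1) <= #|A| + #|[set w | q w == q v]| +
    (\sum_w c v w + \sum_(w | w \notin A) c v w).
  move=> vA; set F := [set w | q w == q v].
  have FA : F \subset A := clA v vA.
  rewrite [\sum_w c v w](bigID (mem A)) /=.
  set s := \sum_(w in A) _; set r := \sum_(w | w \notin A) _.
  have sA : s + #|F| <= #|A|.
    rewrite -(cardsID F A) (setIidPr FA) addnC leq_add2l -sum1_card /s.
    rewrite big_mkcond [X in _ <= X]big_mkcond /=; apply: leq_sum => w _.
    rewrite !inE /c [q v == _]eq_sym; case: (w \in A) => //=.
    by rewrite andbT; case: (adj v w) => //=; case: (_ == _).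
  have dv : d + 1 <= s + r + #|F|.
    have -> : s + r = \sum_w c v w by rewrite [RHS](bigID (mem A)).
    rewrite (cardsD1 v F) inE eqxx /= addnCA addnC leq_add2l.
    apply: leq_trans (dG v) _; rewrite /degree -sum1_card big_mkcond.
    rewrite -sum1_card [X in _ + X]big_mkcond -big_split /=.
    apply: leq_sum => w _; rewrite !inE /c [q v == _]eq_sym.
    have [->|wv] := eqVneq w v; first by rewrite adj_irr.
    by case: (adj v w) => //=; case: (_ == _).
  lia.
have : #|A| * (2 * (d + 1)) <= #|A| * #|A| + \sum_(v in A) #|[set w | q w == q v]|
    + \sum_(v in A) (\sum_w c v w + \sum_(w | w \notin A) c v w).
  by rewrite -!sum_nat_const -!big_split; exact: leq_sum.
move: split_sum; set X := \sum_(v in A) (_ + _).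
rewrite -mulnn; lia.
Qed.

Lemma sqr_div4 d : d ^ 2 %/ 4 = d./2 ^ 2 + odd d * d./2.
Proof.
rewrite -[in LHS](odd_double_half d) -!mulnn -muln2.
by case: (odd d) => /=; nia.
Qed.

(** Put [d = 2h + b], [s = h - p], [r = h - q]. The right side minus the left is [2b(h - 1 - p - q)
    + 2(p + q)(h - 1) - (p + q)^2 - p^2 - q^2], which is nonnegative because [p + q < h]. *)
Lemma two_parts_arith {d s r} : s <= d./2 -> r <= d./2 -> d./2 < s + r ->
  2 * ((d ^ 2) %/ 4 + d) + (s + r) ^ 2 + (s ^ 2 + r ^ 2) <= 2 * (d + 1) * (s + r).
Proof.
rewrite sqr_div4; have := odd_double_half d.
move: (odd d) d./2 => b h dE sh rh hsr.
have [p pE] : exists p, h = s + p by exists (h - s); lia.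
have [q qE] : exists q, h = r + q by exists (h - r); lia.
have pq : (p + q) * (p + q + 1) <= (p + q) * h by rewrite leq_mul2l; lia.
by rewrite -dE -!mulnn; case: b {dE} => /=; nia.
Qed.

Lemma cross_edges_ge {G : sgraph} {K : eqType} {q : G -> K} {U : {set G}} {d} :
    (forall v : G, d <= degree v) ->
    {in U, forall v, [set w | q w == q v] \subset U} ->
    {in U, forall v, #|[set w | q w == q v]| <= d./2} ->
    d./2 < #|U| ->
  (d ^ 2) %/ 4 + d <= #|cross_edges q|.
Proof.
move=> dG clU smallU bigU.
pose F v := [set w | q w == q v].
pose good (A : {set G}) :=
  [&& A \subset U, [forall v in A, F v \subset A] & d./2 < #|A|].
have goodU : good U.
  by apply/and3P; split=> //; apply/forall_inP.
case: (@arg_minnP _ U good (fun A => #|A|) goodU) =>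
  A /and3P[AU /forall_inP clA bigA] minA.
have /card_gt0P[v vA] : 0 < #|A| by exact: leq_ltn_trans bigA.
have vU := subsetP AU v vA.
(* Deleting one class leaves a union of classes, too small by minimality of [A]. *)
have rest : #|A :\: F v| <= d./2.
  rewrite leqNgt; apply/negP => bigAF.
  have : good (A :\: F v).
    apply/and3P; split=> //; first exact: subset_trans (subsetDl _ _) AU.
    apply/forall_inP => w /setDP[wA]; rewrite inE => wv.
    apply/subsetP => x xw; rewrite inE (subsetP (clA w wA) x xw) andbT.
    by move: xw; rewrite !inE => /eqP->.
  move/minA; apply/negP; rewrite -ltnNge; apply: proper_card.
  apply/properP; split; first exact: subsetDl.
  by exists v; rewrite // !inE eqxx.
have cardA : #|A| = #|F v| + #|A :\: F v|.
  by rewrite -(cardsID (F v) A) (setIidPr (clA v vA)).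
(* The class of a vertex of [A] outside [F v] lies within [A :\: F v]. *)
have sumF : \sum_(w in A) #|F w| <= #|F v| ^ 2 + #|A :\: F v| ^ 2.
  rewrite (bigID (mem (F v))) /= -!mulnn -!sum_nat_const; apply: leq_add.
    rewrite [X in X <= _](eq_bigl (mem (F v))); last first.
      by move=> w; apply: andb_idl => /(subsetP (clA v vA)).
    apply: leq_sum => w wF; have : w \in F v by [].
    by rewrite inE /F => /eqP->.
  rewrite [X in X <= _](eq_bigl (mem (A :\: F v))); last first.
    by move=> w; rewrite !inE andbC.
  apply: leq_sum => w /setDP[wA]; rewrite inE => wv.
  apply/subset_leq_card/subsetP => x xw; rewrite inE (subsetP (clA w wA) x xw) andbT.
  by move: xw; rewrite !inE => /eqP->.
have := cross_edges_lower dG clA.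
have := two_parts_arith (smallU v vU) rest; rewrite -cardA => /(_ bigA).
move: sumF; rewrite /F; lia.
Qed.

End Counting.

(** * A large bag in every tree decomposition of the line graph *)

Section LineGraph.
Local Open Scope nat_scope.

Lemma line_graph_bag {G T : sgraph} {B : T -> {set line_graph G}} {d} :
    tree_decomposition B -> (forall v : G, d <= degree v) -> 0 < #|G| ->
  exists t, (d ^ 2) %/ 4 + d <= #|B t|.
Proof.
case=> treeT coverB connB edgeB dG /card_gt0P[v0 _].
have [d0|d_gt0] := posnP d.
  by case: treeT => /card_gt0P[t _] _ _; exists t; rewrite d0.
have edge_at (v : G) : exists e : edge G, v \in val e.
  have /card_gt0P[w] : 0 < degree v by exact: leq_trans (dG v).
  rewrite inE => vw.
  have vwE : [set v; w] \in edges G by apply/imsetP; exists (v, w); rewrite ?inE.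
  by exists (Sub [set v; w] vwE); rewrite SubK !inE eqxx.
have home (v : G) : exists t, [forall e : edge G, (v \in val e) ==> (e \in B t)].
  have [e0 e0P] := edge_at v.
  pose I := {e : edge G | v \in val e}.
  have [||t tP] := @helly_tree T I (fun i => [set t | (val i : line_graph G) \in B t])
    (Sub e0 e0P) treeT.
  - by move=> i; exact: connB.
  - move=> [e ve] [f vf] /=; have [ef|ef] := eqVneq e f.
      have [t et] := coverB e.
      by apply/set0Pn; exists t; rewrite !inE -ef et.
    have /edgeB[t /andP[et ft]] : @adj (line_graph G) e f.
      by rewrite /= /line_adj ef; apply/set0Pn; exists v; rewrite inE ve vf.
    by apply/set0Pn; exists t; rewrite !inE et ft.
  exists t; apply/forallP => e; apply/implyP => ve.
  by have := tP (Sub e ve : I); rewrite inE SubK.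
have [b bP] := fin_all_exists home.
have bB v (e : edge G) : v \in val e -> (e : line_graph G) \in B (b v).
  by move=> ve; have /forallP/(_ e)/implyP := bP v; exact.
have [D [[r Dr] closedD child]] := tree_branches treeT.
pose U t := [set v | b v \in D t].
(* For [d = 1] the bound is 1, so a nonempty bag suffices. Later [d > 1] makes singleton classes no
   larger than [d./2]. *)
have [d_le1|d_gt1] := leqP d 1.
  have [e e0] := edge_at v0; exists (b v0).
  have /card_gt0P : exists f, f \in B (b v0) by exists e; exact: bB.
  by have -> : d = 1 by lia.
have bigU : d./2 < #|U r|.
  have -> : U r = [set: G] by apply/setP=> v; rewrite !inE Dr inE.
  by rewrite cardsT; have := degree_lt_card v0; have := dG v0; lia.
case: (@arg_minnP _ r (fun t => d./2 < #|U t|) (fun t => #|D t|) bigU) =>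
  t {}bigU minU.
(* A vertex with home [t] is labelled by itself, any other by the representative of its home's
   component in [T - t]. *)
pose q v : G + T := if b v == t then inl v else inr (fingraph.root (avoid t) (b v)).
have qE v w : b v != t -> q w = q v -> connect (avoid t) (b v) (b w).
  rewrite /q => /negbTE->; case: eqP => // _ [E].
  by rewrite -(root_connect (connect_avoid_sym t)) E.
(* The nodes whose bag contains the edge [vw] connect [b v] to [b w], so they
   include [t] unless [b v] and [b w] lie in one component of [T - t]. *)
have cross : cross_edges q \subset [set val e | e : edge G in B t].
  apply/subsetP => _ /imsetP[[v w] + ->]; rewrite inE /= => /andP[vw qvw].
  have vwE : [set v; w] \in edges G by apply/imsetP; exists (v, w); rewrite ?inE.
  pose e : edge G := Sub [set v; w] vwE.
  apply/imsetP; exists e => //; apply/negPn/negP => et.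
  have ev : (e : line_graph G) \in B (b v) by apply: bB; rewrite SubK !inE eqxx.
  have ew : (e : line_graph G) \in B (b w) by apply: bB; rewrite SubK !inE eqxx orbT.
  have bvt : b v != t by apply: contraNneq et => <-.
  have bwt : b w != t by apply: contraNneq et => <-.
  case/negP: qvw; rewrite /q (negbTE bvt) (negbTE bwt); apply/eqP; congr inr.
  apply/eqP; rewrite (root_connect (connect_avoid_sym t)).
  by apply: connected_in_avoid (connB e) _ _ _; rewrite inE.
exists t; apply: leq_trans (_ : #|cross_edges q| <= _); last first.
  by apply: leq_trans (subset_leq_card cross) (leq_imset_card _ _).
apply: cross_edges_ge bigU => // v; rewrite inE => vt.
  apply/subsetP => w; rewrite !inE => /eqP qwv.
  have [bvt|bvt] := eqVneq (b v) t.
    by move: qwv; rewrite /q bvt eqxx; case: eqP => [-> _|//]; rewrite -{1}bvt.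
  exact: closedD vt bvt (qE _ _ bvt qwv).
have [bvt|bvt] := eqVneq (b v) t.
  apply: leq_trans (_ : 1 <= _); last by rewrite half_gt0.
  rewrite -(cards1 v); apply/subset_leq_card/subsetP => w.
  by rewrite !inE /q bvt eqxx; case: (b w =P t) => // _ /eqP[->].
(* The class of [v] has its homes in the smaller subtree [D c], to which the minimality of [t]
   applies. *)
have [c ltc cP] := child t (b v) vt bvt.
apply: leq_trans (_ : #|U c| <= _).
  apply/subset_leq_card/subsetP => w; rewrite !inE => /eqP/(qE _ _ bvt); exact: cP.
by rewrite leqNgt; apply/negP => /minU; rewrite leqNgt ltc.
Qed.

End LineGraph.

Theorem theorem1p2 (G : sgraph) (G_nonempty : (0 < #|G|)%N) :
  let d : rat := (min_degree G)%:R in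
  treewidth (line_graph G) <= pathwidth (line_graph G) /\
  (if odd (min_degree G)
   then 1 / 4 * d ^+ 2 + d - 5 / 4
   else 1 / 4 * d ^+ 2 + d - 1) <= (treewidth (line_graph G))%:~R.
Proof.
move=> d; rewrite /treewidth /pathwidth.
case: ex_minnP => n /boolp.asboolP[T [B [dB widthB]]] minT.
case: ex_minnP => m /boolp.asboolP[T' [B' [dB' _ widthB']]] _; split.
  rewrite lerD2r lez_nat; apply: minT; apply/boolp.asboolP.
  by exists T', B'.
have [t tP] := line_graph_bag dB min_degree_le G_nonempty.
have le_n : ((min_degree G) ^ 2 %/ 4 + min_degree G <= n)%N.
  apply: leq_trans tP _; have -> : n = (\max_i #|B i|)%N.
    by move: widthB; rewrite /width; lia.
  exact: leq_bigmax.
(* For odd degree the floor of [d^2 / 4] is [(d^2 - 1) / 4], which turns the constant 1 into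
   [5 / 4]. *)
rewrite intrB {}/d; move: le_n; rewrite sqr_div4 -(ler_nat rat) !natrD natrM natrX.
have := congr1 (fun k => k%:R : rat) (odd_double_half (min_degree G)).
rewrite -muln2 natrD natrM => <-.
case: (odd _); rewrite /=; nra.
Qed.
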